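(* Let $d\in\{2,3\}$ and let $f$ be an energy density satisfying the Energy Density Assumption on the interval $I$ (see context). Let $\Gamma^m$, $H^m\in\mathbb K^m$ and $\tau_m>0$ be given, and suppose that $$(\boldsymbol X^{m+1},\mu^{m+1},H^{m+1},r^{m+1})\in[\mathbb K^m]^d\times(\mathbb K^m)^3$$ satisfies, for all $\varphi,\psi,\zeta\in\mathbb K^m$ and all $\boldsymbol\omega\in[\mathbb K^m]^d$, $$\Big(\tfrac{\delta\boldsymbol X^{m+1}}{\tau_m}\cdot\boldsymbol n^{m+\frac12},\varphi\Big)^h_{\Gamma^m}=-(\nabla_{\Gamma^m}\mu^{m+1},\nabla_{\Gamma^m}\varphi)^h_{\Gamma^m},$$ $$(\mu^{m+1}\boldsymbol n^{m+\frac12},\boldsymbol\omega)^h_{\Gamma^m}=\mathcal D^k_m(\boldsymbol X^{m+1},\boldsymbol\omega;H^{m+1})+\mathcal B_m(\boldsymbol\omega,r^{m+1}),$$ $$(\delta H^{m+1},\psi)^h_{\Gamma^m}=\mathcal B_m(\delta\boldsymbol X^{m+1},\psi),$$ $$(r^{m+1},\zeta)^h_{\Gamma^m}=(f_H(\boldsymbol n^m,H^{m+1}),\zeta)^h_{\Gamma^m},$$ where the stabilizing function $k\ge0$ satisfies $k(\boldsymbol n^m_j,H^{m+1}_{j_\ell})\ge k_0(\boldsymbol n^m_j,H^{m+1}_{j_\ell})$ for $1\le j\le J$, $1\le\ell\le d$. Assume that all elements $\sigma^m_j$ of $\Gamma^m$ and $\sigma^{m+1}_j$ of $\Gamma^{m+1}$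 are nondegenerate and that all nodal curvature values $H^m_i,H^{m+1}_i$ lie in $I$. Then $$V^{m+1}=V^m,\qquad W^{m+1}+\tau_m\|\nabla_{\Gamma^m}\mu^{m+1}\|^2_{L^2(\Gamma^m)}\le W^m .$$
   Context: **Density.** $d\in\{2,3\}$, $I\subseteq\mathbb R$ is an interval, $f:\mathbb S^{d-1}\times\mathbb R\to\mathbb R_{>0}$; $f_H$ is the derivative of $f$ in its second argument, and $\boldsymbol a(\boldsymbol n,s)=\nabla_{\mathbb S^{d-1}}f(\boldsymbol n,s)$ is the spherical (tangential) gradient in the first argument with $s$ fixed. *Energy Density Assumption on $I$:* for every $s\in I$, $f(\cdot,s)$ is positive and in $C^2(\mathbb S^{d-1})$, and $(5-d)f(\boldsymbol n,s)-f(-\boldsymbol n,s)\ge 0$ for all $(\boldsymbol n,s)\in\mathbb S^{d-1}\times I$; and for each $\boldsymbol n\in\mathbb S^{d-1}$, $s\mapsto f(\boldsymbol n,s)$ is continuously differentiable and convex on $I$. **Surface energy matrix.** With $\boldsymbol\xi(\boldsymbol n,s)=f(\boldsymbol n,s)\boldsymbol n+\boldsymbol a(\boldsymbol n,s)$ and a stabilizing function $k:\mathbb S^{d-1}\times I\to[0,\infty)$, $$\boldsymbol Z_k(\boldsymbol n,s)=f(\boldsymbol n,s)I_d-\boldsymbol n\boldsymbol\xi^T-\boldsymbol\xi\boldsymbol n^T+k(\boldsymbol n,s)\boldsymbol n\boldsymbol n^T .$$ **Discrete surfaces.** An oriented $(d-1)$-simplex $\sigma=[\boldsymbol q_1,\dots,\boldsymbol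 q_d]\subset\mathbb R^d$ (segment for $d=2$, triangle for $d=3$) has orientation vector $\mathcal J\{\sigma\}=(\boldsymbol q_2-\boldsymbol q_1)^\perp$ for $d=2$, where $(v_1,v_2)^\perp=(v_2,-v_1)$, and $\mathcal J\{\sigma\}=(\boldsymbol q_2-\boldsymbol q_1)\times(\boldsymbol q_3-\boldsymbol q_1)$ for $d=3$; its measure is $|\sigma|=|\mathcal J\{\sigma\}|/(d-1)$ and its unit normal is $\mathcal J\{\sigma\}/|\mathcal J\{\sigma\}|$. Nondegenerate means $|\sigma|>0$. $\Gamma^m=\bigcup_{j=1}^J\overline{\sigma^m_j}$, $\sigma^m_j=[\boldsymbol q^m_{j_1},\dots,\boldsymbol q^m_{j_d}]$, is a closed polygonal curve ($d=2$) or closed triangulated surface ($d=3$) with vertex orderings consistent with the outward orientation; $\boldsymbol n^m$ is the piecewise constant normal with value $\boldsymbol n^m_j$ on $\sigma^m_j$. $\mathbb K^m$ is the space of continuous functions on $\Gamma^m$ that are affine on each element. For $u$ affine on a simplex, $\nabla_{\Gamma^m}u$ is its constant tangential gradient; for vector fields $(\nabla_{\Gamma^m}\boldsymbol w)$ has rows $(\nabla_{\Gamma^m}w_i)^T$. $\boldsymbol X^m=\mathrm{id}$ on $\Gamma^m$. $\boldsymbol X^{m+1}\in[\mathbb K^m]^d$ maps each vertex $\boldsymbol q^m_i$ to $\boldsymbol q^{m+1}_i$, and $\Gamma^{m+1}$ has the same connectivity, with elements $\sigma_j^{m+1}=[\boldsymbol q^{m+1}_{j_1},\dots,\boldsymbol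 q^{m+1}_{j_d}]$ and normals $\boldsymbol n_j^{m+1}$. $\delta\boldsymbol X^{m+1}=\boldsymbol X^{m+1}-\boldsymbol X^m$, $\delta H^{m+1}=H^{m+1}-H^m$. Nodal values $H^{m+1}_i$ are carried to the corresponding vertices of $\Gamma^{m+1}$; $H_{j_\ell}$ is the nodal value at the $\ell$th vertex of element $j$. **Time-averaged normal.** On $\sigma^m_j$, $$\boldsymbol n^{m+\frac12}\big|_{\sigma^m_j}=\frac{\mathcal J\{\sigma^m_j\}+4\mathcal J\{\sigma^{m+\frac12}_j\}+\mathcal J\{\sigma^{m+1}_j\}}{6|\mathcal J\{\sigma^m_j\}|},\qquad \sigma^{m+\frac12}_j=\Big[\tfrac{\boldsymbol q^m_{j_1}+\boldsymbol q^{m+1}_{j_1}}2,\dots,\tfrac{\boldsymbol q^m_{j_d}+\boldsymbol q^{m+1}_{j_d}}2\Big].$$ **Quadrature.** For piecewise continuous $u,v$ with $u_{j\ell}$ the limit of $u$ at $\boldsymbol q^m_{j_\ell}$ from inside $\sigma^m_j$, $$(u,v)^h_{\Gamma^m}=\frac1d\sum_{j=1}^J\sum_{\ell=1}^d|\sigma^m_j|\,u_{j\ell}v_{j\ell},$$ with the dot product for vectors; $\langle\cdot,\cdot\rangle^h_{\Gamma^m}$ is the same with the Frobenius product $U:V=\mathrm{tr}(U^TV)$ for matrices. Nonlinear coefficients are evaluated at traces, e.g. $f_H(\boldsymbol n^m,H^{m+1})_{j\ell}=f_H(\boldsymbol n^m_j,H^{m+1}_{j_\ell})$, and likewise for $\boldsymbol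 Z_k$. $\|\cdot\|_{L^2(\Gamma^m)}$ is the exact $L^2$ norm on $\Gamma^m$. **Forms.** At vertex $i$ let $\mathcal T^m_i$ be the indices of incident elements and $\boldsymbol N^m_i=\sum_{j\in\mathcal T^m_i}|\sigma^m_j|\boldsymbol n^m_j\big/\big|\sum_{j\in\mathcal T^m_i}|\sigma^m_j|\boldsymbol n^m_j\big|$ (denominator assumed nonzero), and let $\boldsymbol N^m\in[\mathbb K^m]^d$ interpolate these values. On each element, $\boldsymbol P^m=I_d-\boldsymbol n^m(\boldsymbol n^m)^T$ and $\boldsymbol A^m=\boldsymbol P^m\,\tfrac12\big(\nabla_{\Gamma^m}\boldsymbol N^m+(\nabla_{\Gamma^m}\boldsymbol N^m)^T\big)\boldsymbol P^m$. Define $$\mathcal B_m(\boldsymbol w,\psi)=\langle\boldsymbol n^m(\nabla_{\Gamma^m}\psi)^T-\psi\boldsymbol A^m,\nabla_{\Gamma^m}\boldsymbol w\rangle^h_{\Gamma^m},$$ $$\mathcal D^k_m(\boldsymbol Y,\boldsymbol\omega;H)=\langle\boldsymbol Z_k(\boldsymbol n^m,H)\nabla_{\Gamma^m}\boldsymbol Y,\nabla_{\Gamma^m}\boldsymbol\omega\rangle^h_{\Gamma^m}.$$ **Threshold $k_0$.** $k_0:\mathbb S^{d-1}\times I\to[0,\infty)$ is a threshold function with the following property (such a finite $k_0$ exists for densities satisfying the Assumption): for every $s\in I$, every oriented nondegenerate $(d-1)$-simplex $\sigma$ with normal $\boldsymbol n$, every affine map $\boldsymbol X$ of $\sigma$ onto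 a nondegenerate simplex $\bar\sigma$ preserving the vertex ordering, with induced normal $\bar{\boldsymbol n}$, and every value $k(\boldsymbol n,s)\ge k_0(\boldsymbol n,s)$, $$|\sigma|\,\big(\boldsymbol Z_k(\boldsymbol n,s)\nabla_\sigma\boldsymbol X\big):\big(\nabla_\sigma\boldsymbol X-\nabla_\sigma\mathrm{id}\big)\ge|\bar\sigma|f(\bar{\boldsymbol n},s)-|\sigma|f(\boldsymbol n,s),$$ where $\nabla_\sigma$ is the tangential Jacobian on $\sigma$ (so $\nabla_\sigma\mathrm{id}=I_d-\boldsymbol n\boldsymbol n^T$). **Discrete energy and volume.** $W^m=\frac1d\sum_{j=1}^J|\sigma^m_j|\sum_{\ell=1}^d f(\boldsymbol n^m_j,H^m_{j_\ell})$ and $V^m=\frac1{d^2}\sum_{j=1}^J|\sigma^m_j|\sum_{\ell=1}^d\boldsymbol q^m_{j_\ell}\cdot\boldsymbol n^m_j$ (oriented enclosed area or volume); $W^{m+1},V^{m+1}$ are the same expressions with $m+1$ in place of $m$ throughout. *)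

(* Defs.v *)
From HB Require Import structures.
From mathcomp Require Import all_boot all_order all_algebra.
From mathcomp Require Import all_classical all_reals all_analysis.
Set Implicit Arguments.
Unset Strict Implicit.
Unset Printing Implicit Defensive.
Import Order.TTheory GRing.Theory Num.Theory.
Import numFieldNormedType.Exports.
Local Open Scope classical_set_scope.
Local Open Scope ring_scope.

Section Euclidean.
Context {R : realType}.

(* Frobenius product U : V; on column vectors it is the dot product. The norm
   `|_| that the library puts on matrices is the maximum norm, hence enorm. *)
Definition inner (p r : nat) (U V : 'M[R]_(p, r)) : R := \tr (U^T *m V).
Definition enorm (d : nat) (v : 'cV[R]_d) : R := Num.sqrt (inner v v).
Definition sphere (d : nat) : set 'cV[R]_d := [set n | enorm n = 1].

Definition perp (v : 'cV[R]_2) : 'cV[R]_2 :=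
  \col_(i < 2) [:: v 1 0; - v 0 0]`_i.
Definition cross (v w : 'cV[R]_3) : 'cV[R]_3 :=
  \col_(i < 3) [:: v 1 0 * w 2 0 - v 2 0 * w 1 0;
                   v 2 0 * w 0 0 - v 0 0 * w 2 0;
                   v 0 0 * w 1 0 - v 1 0 * w 0 0]`_i.

End Euclidean.

Section Simplex.
Context {R : realType}.

Definition hull (I : finType) (d : nat) (q : I -> 'cV[R]_d) (A : {set I}) :
    set 'cV[R]_d :=
  [set x | exists l : I -> R, [/\ forall i, 0 <= l i,
     forall i, i \notin A -> l i = 0, \sum_i l i = 1 &
     x = \sum_i l i *: q i]].

(* An oriented (d-1)-simplex is the family q of its d ordered vertices. *)
Definition simplex (d : nat) (q : 'I_d -> 'cV[R]_d) : set 'cV[R]_d :=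
  hull q [set: 'I_d].

Definition rel_interior (d : nat) (q : 'I_d -> 'cV[R]_d) : set 'cV[R]_d :=
  [set x | exists l : 'I_d -> R, [/\ forall i, 0 < l i, \sum_i l i = 1 &
     x = \sum_i l i *: q i]].

(* Only d = 2 and d = 3 are meaningful, here and in simplex_integral. *)
Definition orientation (d : nat) : ('I_d -> 'cV[R]_d) -> 'cV[R]_d :=
  match d return ('I_d -> 'cV[R]_d) -> 'cV[R]_d with
  | 2%N => fun q => perp (q 1 - q 0)
  | 3%N => fun q => cross (q 1 - q 0) (q 2 - q 0)
  | _ => fun=> 0
  end.

Definition area (d : nat) (q : 'I_d -> 'cV[R]_d) : R :=
  enorm (orientation q) / d.-1%:R.
Definition unit_normal (d : nat) (q : 'I_d -> 'cV[R]_d) : 'cV[R]_d :=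
  (enorm (orientation q))^-1 *: orientation q.
Definition nondegenerate_simplex (d : nat) (q : 'I_d -> 'cV[R]_d) : Prop :=
  0 < area q.

(* Surface integral over the simplex, through its affine parametrization by
   the reference simplex, whose Jacobian is |orientation q|. *)
Definition simplex_integral (d : nat) :
    ('I_d -> 'cV[R]_d) -> ('cV[R]_d -> R) -> R :=
  match d return ('I_d -> 'cV[R]_d) -> ('cV[R]_d -> R) -> R with
  | 2%N => fun q g => enorm (orientation q) *
      \int[lebesgue_measure]_(s in `[0, 1]) g (q 0 + s *: (q 1 - q 0))
  | 3%N => fun q g => enorm (orientation q) *
      \int[lebesgue_measure]_(s in `[0, 1])
        \int[lebesgue_measure]_(t in `[0, 1 - s])
          g (q 0 + s *: (q 1 - q 0) + t *: (q 2 - q 0))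
  | _ => fun _ _ => 0
  end.

Definition affine_on (d : nat) (S : set 'cV[R]_d) (u : 'cV[R]_d -> R) : Prop :=
  exists (a : 'cV[R]_d) (c : R), forall x, S x -> u x = inner a x + c.

(* The constant tangential gradient of a function that is affine on the
   simplex; it exists and is unique when the simplex is nondegenerate. *)
Definition grad (d : nat) (q : 'I_d -> 'cV[R]_d) (u : 'cV[R]_d -> R) :
    'cV[R]_d :=
  get [set g : 'cV[R]_d | inner g (unit_normal q) = 0 /\
    forall x y, simplex q x -> simplex q y -> u y - u x = inner g (y - x)].

Definition jac (d : nat) (q : 'I_d -> 'cV[R]_d) (w : 'cV[R]_d -> 'cV[R]_d) :
    'M[R]_d :=
  \matrix_(i, j) grad q (fun x => w x i 0) j 0.

End Simplex.

Section Density.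
Context {R : realType} {d : nat}.
Implicit Types (I : set R) (f : 'cV[R]_d -> R -> R).

Definition C1_on (A : set 'cV[R]_d) (g : 'cV[R]_d -> R) : Prop :=
  forall (i : 'I_d) (x : 'cV[R]_d), A x ->
    derivable g x (delta_mx i 0) /\
    {for x, continuous (fun y => 'D_(delta_mx i 0) g y)}.
Definition C2_on (A : set 'cV[R]_d) (g : 'cV[R]_d -> R) : Prop :=
  C1_on A g /\ forall i : 'I_d, C1_on A (fun y => 'D_(delta_mx i 0) g y).

(* Extension of a function on the sphere that is constant along rays: g is C^2
   on the sphere iff radial g is C^2 away from the origin, and on the sphere the
   Euclidean gradient of radial g is the spherical gradient of g. *)
Definition radial (g : 'cV[R]_d -> R) : 'cV[R]_d -> R :=
  fun x => g ((enorm x)^-1 *: x).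
Definition C2_sphere (g : 'cV[R]_d -> R) : Prop :=
  C2_on [set x | x != 0] (radial g).
Definition sphere_grad (g : 'cV[R]_d -> R) (n : 'cV[R]_d) : 'cV[R]_d :=
  \col_i 'D_(delta_mx i 0) (radial g) n.

(* Derivative relative to I, hence one-sided at an end point that belongs
   to I. *)
Definition diff_quot (g : R -> R) (s t : R) : R := (t - s)^-1 * (g t - g s).
Definition derivable_in I (g : R -> R) (s : R) : Prop :=
  cvg (diff_quot g s t @[t --> within I s^']).
Definition deriv_in I (g : R -> R) (s : R) : R :=
  lim (diff_quot g s t @[t --> within I s^']).

(* Densities f(n,s) and stabilizing functions are total functions of which only
   the values at n on the sphere matter. *)
Definition fH I f (n : 'cV[R]_d) (s : R) : R := deriv_in I (f n) s.

Record energy_density_assumption I f : Prop := {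
  eda_pos : forall n s, sphere n -> I s -> 0 < f n s;
  eda_C2 : forall s, I s -> C2_sphere (f ^~ s);
  eda_opp : forall n s, sphere n -> I s ->
    0 <= (5 - d%:R) * f n s - f (- n) s;
  eda_derivable : forall n, sphere n ->
    forall s, I s -> derivable_in I (f n) s;
  eda_C1 : forall n, sphere n -> {within I, continuous (fH I f n)};
  eda_convex : forall n, sphere n -> @convex_function R R^o I (f n) }.

Definition xi f (n : 'cV[R]_d) (s : R) : 'cV[R]_d :=
  f n s *: n + sphere_grad (f ^~ s) n.

(* The matrix Z_k(n,s), where c is the value k(n,s). *)
Definition Zmx f (c : R) (n : 'cV[R]_d) (s : R) : 'M[R]_d :=
  (f n s)%:M - n *m (xi f n s)^T - xi f n s *m n^T + c *: (n *m n^T).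

Record threshold I f (k0 : 'cV[R]_d -> R -> R) : Prop := {
  thr_ge0 : forall n s, sphere n -> I s -> 0 <= k0 n s;
  thr_ineq : forall (s : R) (q : 'I_d -> 'cV[R]_d)
      (X : 'cV[R]_d -> 'cV[R]_d) (c : R),
    I s -> nondegenerate_simplex q ->
    (forall i, affine_on (simplex q) (fun x => X x i 0)) ->
    nondegenerate_simplex (X \o q) ->
    k0 (unit_normal q) s <= c ->
    area q * inner (Zmx f c (unit_normal q) s *m jac q X) (jac q X - jac q id) >=
    area (X \o q) * f (unit_normal (X \o q)) s - area q * f (unit_normal q) s }.

End Density.

(* elt j l is the index of the l-th vertex of element j. *)
Record connectivity (d : nat) := Connectivity {
  nvert : nat;
  nelt : nat;
  elt : 'I_nelt -> 'I_d -> 'I_nvert }.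

Definition verts (d : nat) (T : connectivity d) (j : 'I_(nelt T)) :
    {set 'I_(nvert T)} := [set elt j l | l : 'I_d].
Definition incident (d : nat) (T : connectivity d) (i : 'I_(nvert T)) :
    {set 'I_(nelt T)} := [set j | i \in verts j].

(* Closedness and consistent orientation. For d = 2, every vertex is the initial
   point of exactly one segment and the final point of exactly one segment. *)
Definition closed_curve (T : connectivity 2) : Prop :=
  forall i : 'I_(nvert T),
    #|[set j : 'I_(nelt T) | elt j 0 == i]| = 1%N /\
    #|[set j : 'I_(nelt T) | elt j 1 == i]| = 1%N.

(* Occurrences of (a, b) as a positively directed edge of a triangle. *)
Definition dir_edges (T : connectivity 3) (a b : 'I_(nvert T)) :
    {set 'I_(nelt T) * 'I_3} :=
  [set jl | (elt jl.1 jl.2 == a) && (elt jl.1 (ordS jl.2) == b)].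

(* For d = 3, two triangles meet at every edge, which they traverse in opposite
   directions, and the triangles around a vertex form a single cycle. *)
Definition closed_triangulation (T : connectivity 3) : Prop :=
  (forall a b : 'I_(nvert T),
     (#|dir_edges a b| <= 1)%N /\ #|dir_edges a b| = #|dir_edges b a|) /\
  (forall (i : 'I_(nvert T)) (j j' : 'I_(nelt T)),
     j \in incident i -> j' \in incident i ->
     connect (fun j1 j2 => [&& j1 \in incident i, j2 \in incident i &
       [exists i', (i' != i) && (i' \in verts j1 :&: verts j2)]]) j j').

Definition closed_oriented (d : nat) : connectivity d -> Prop :=
  match d return connectivity d -> Prop with
  | 2%N => closed_curve
  | 3%N => closed_triangulation
  | _ => fun=> False
  end.

Section Surface.
Context {R : realType} {d : nat} (T : connectivity d).
Implicit Types (q : 'I_(nvert T) -> 'cV[R]_d) (j : 'I_(nelt T)) (l : 'I_d).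
Implicit Types (w : 'cV[R]_d -> 'cV[R]_d) (u : 'cV[R]_d -> R).

Definition elem q j : 'I_d -> 'cV[R]_d := fun l => q (elt j l).
Definition nu q j : 'cV[R]_d := unit_normal (elem q j).
Definition surface q : set 'cV[R]_d :=
  \bigcup_(j in [set: 'I_(nelt T)]) simplex (elem q j).

(* Two elements meet exactly in their common face. *)
Definition conforming q : Prop :=
  injective q /\ forall j j',
    simplex (elem q j) `&` simplex (elem q j') =
    hull q (verts j :&: verts j').

(* The surface bounds a region that lies on the negative side of each
   element. *)
Definition outward q : Prop :=
  exists Om : set 'cV[R]_d,
    [/\ Om !=set0, open Om, bounded_set Om, closure Om `\` Om = surface q &
      forall j x, rel_interior (elem q j) x ->
        \forall t \near 0^'+,
          Om (x - t *: nu q j) /\ ~ closure Om (x + t *: nu q j)].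

Record closed_surface q : Prop := {
  cs_closed : closed_oriented T;
  cs_conforming : conforming q;
  cs_outward : outward q }.

(* The finite element space, as functions on the whole space of which only the
   restriction to the surface matters. *)
Definition fespace q : set ('cV[R]_d -> R) :=
  [set u | {within surface q, continuous u} /\
           forall j, affine_on (simplex (elem q j)) u].
Definition fevspace q : set ('cV[R]_d -> 'cV[R]_d) :=
  [set w | forall i : 'I_d, fespace q (fun x => w x i 0)].

(* A piecewise continuous field enters the quadrature through its traces
   u_{jl} at the vertices of the elements. *)
Definition traces (V : Type) q (u : 'cV[R]_d -> V) :
    'I_(nelt T) -> 'I_d -> V := fun j l => u (elem q j l).
Definition quad q (u v : 'I_(nelt T) -> 'I_d -> R) : R :=
  d%:R^-1 * \sum_j \sum_l area (elem q j) * (u j l * v j l).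
Definition quadv (p r : nat) q
    (U V : 'I_(nelt T) -> 'I_d -> 'M[R]_(p, r)) : R :=
  d%:R^-1 * \sum_j \sum_l area (elem q j) * inner (U j l) (V j l).

Definition L2norm q (U : 'I_(nelt T) -> 'cV[R]_d -> 'cV[R]_d) : R :=
  Num.sqrt (\sum_j simplex_integral (elem q j) (fun x => enorm (U j x) ^+ 2)).

Definition gradT q u : 'I_(nelt T) -> 'cV[R]_d := fun j => grad (elem q j) u.
Definition jacT q w : 'I_(nelt T) -> 'M[R]_d := fun j => jac (elem q j) w.

Definition normal_half q q' j : 'cV[R]_d :=
  (6 * enorm (orientation (elem q j)))^-1 *:
    (orientation (elem q j)
     + 4 *: orientation (fun l => 2^-1 *: (elem q j l + elem q' j l))
     + orientation (elem q' j)).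

Definition vsum q (i : 'I_(nvert T)) : 'cV[R]_d :=
  \sum_(j in incident i) area (elem q j) *: nu q j.
Definition vnormal q (i : 'I_(nvert T)) : 'cV[R]_d :=
  (enorm (vsum q i))^-1 *: vsum q i.

(* The finite element interpolant of vertex values; unique on the surface. *)
Definition interp q (v : 'I_(nvert T) -> 'cV[R]_d) : 'cV[R]_d -> 'cV[R]_d :=
  xget (fun=> 0) [set w | fevspace q w /\ forall i, w (q i) = v i].

Definition tproj q j : 'M[R]_d := 1%:M - nu q j *m (nu q j)^T.
Definition weingarten q j : 'M[R]_d :=
  let G := jacT q (interp q (vnormal q)) j in
  tproj q j *m (2^-1 *: (G + G^T)) *m tproj q j.

Definition Bform q w u : R :=
  quadv q (fun j l => nu q j *m (gradT q u j)^T - traces q u j l *: weingarten q j)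
          (fun j _ => jacT q w j).

Definition Dform (f k : 'cV[R]_d -> R -> R) q
    (Y w : 'cV[R]_d -> 'cV[R]_d) (H : 'cV[R]_d -> R) : R :=
  quadv q
    (fun j l => let s := traces q H j l in
       Zmx f (k (nu q j) s) (nu q j) s *m jacT q Y j)
    (fun j _ => jacT q w j).

Definition energy (f : 'cV[R]_d -> R -> R) q (h : 'I_(nvert T) -> R) : R :=
  d%:R^-1 * \sum_j area (elem q j) * \sum_l f (nu q j) (h (elt j l)).
Definition volume q : R :=
  (d%:R ^+ 2)^-1 * \sum_j area (elem q j) * \sum_l inner (elem q j l) (nu q j).

End Surface.

(* Main.v *)
Require Import Defs.
From HB Require Import structures.
From mathcomp Require Import all_boot all_order all_algebra.
From mathcomp Require Import all_classical all_reals all_analysis.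
From mathcomp Require Import ring lra.
Set Implicit Arguments.
Unset Strict Implicit.
Unset Printing Implicit Defensive.
Import Order.TTheory GRing.Theory Num.Theory.
Import numFieldNormedType.Exports.
Local Open Scope classical_set_scope.
Local Open Scope ring_scope.

(** Both conclusions come from choosing test functions.

    Energy.  Testing the four equations with mu, the displacement X - id, r and
    H' - H makes all coupling terms cancel and leaves
      tau |grad mu|^2 = - D(X, X - id; H') - (f_H(n, H'), H' - H)^h.
    On each element the threshold property bounds the integrand of D below by
    the change of |sigma| f(., H') at fixed curvature, and convexity of f in its
    second argument bounds f_H(n, H') (H' - H) below by f(n, H') - f(n, H), which
    accounts for the change of curvature on the old element.  The two changes
    add up to the change of energy at each vertex of each element
    ([element_energy]).  Since mu has a constant gradient on each element, the
    quadrature computes its squared L^2 norm exactly ([L2norm_cst_sqr]).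

    Volume.  Testing the first equation with the constant 1 says that the
    quadrature of (X - id) . n^{m+1/2} vanishes.  The time-averaged normal is
    Simpson's rule for the orientation vector along the linear motion from the
    old to the new vertices; that vector is a polynomial of degree d - 1 <= 2 in
    time, so the rule is exact and the quadrature is the volume swept by the
    elements ([quad_normal_half]).  For a single element the swept volume is not
    the change of the volume of the cone over it: the lateral faces of the cone
    move too.  A vertex contributes with opposite signs as the final and as
    the initial point of a segment (d = 2), an edge with opposite signs in its
    two directions (d = 3) ([cone_diff2], [cone_diff3]), so that the sum of these
    contributions over a closed, consistently oriented surface is zero
    ([cone_sum_swept]). *)

(** * Frobenius product *)

Lemma sum_ord2 (V : nmodType) (F : 'I_2 -> V) : \sum_i F i = F 0 + F 1.
Proof.
by rewrite !big_ord_recl big_ord0 addr0; congr (_ + F _); apply: val_inj.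
Qed.

Lemma sum_ord3 (V : nmodType) (F : 'I_3 -> V) : \sum_i F i = F 0 + F 1 + F 2.
Proof.
rewrite !big_ord_recl big_ord0 addr0 addrA.
by congr (_ + F _ + F _); apply: val_inj.
Qed.

Section Inner.
Context {R : realType}.

Lemma innerE (p r : nat) (U V : 'M[R]_(p, r)) :
  inner U V = \sum_i \sum_j U i j * V i j.
Proof.
rewrite exchange_big; apply: eq_bigr => j _; rewrite mxE.
by apply: eq_bigr => i _; rewrite mxE.
Qed.

Lemma inner_colE (p : nat) (u v : 'cV[R]_p) :
  inner u v = \sum_i u i 0 * v i 0.
Proof. by rewrite innerE; apply: eq_bigr => i _; rewrite big_ord1. Qed.

Lemma innerC (p r : nat) (U V : 'M[R]_(p, r)) : inner U V = inner V U.
Proof. by rewrite /inner -mxtrace_tr trmx_mul trmxK. Qed.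

Lemma innerDl (p r : nat) (U V W : 'M[R]_(p, r)) :
  inner (U + V) W = inner U W + inner V W.
Proof. by rewrite /inner linearD mulmxDl linearD. Qed.

Lemma innerZl (p r : nat) (c : R) (U V : 'M[R]_(p, r)) :
  inner (c *: U) V = c * inner U V.
Proof. by rewrite /inner linearZ -scalemxAl linearZ. Qed.

Lemma innerDr (p r : nat) (U V W : 'M[R]_(p, r)) :
  inner U (V + W) = inner U V + inner U W.
Proof. by rewrite !(innerC U) innerDl. Qed.

Lemma innerZr (p r : nat) (c : R) (U V : 'M[R]_(p, r)) :
  inner U (c *: V) = c * inner U V.
Proof. by rewrite !(innerC U) innerZl. Qed.

Lemma innerBl (p r : nat) (U V W : 'M[R]_(p, r)) :
  inner (U - V) W = inner U W - inner V W.
Proof. by rewrite innerDl -scaleN1r innerZl mulN1r. Qed.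

Lemma innerBr (p r : nat) (U V W : 'M[R]_(p, r)) :
  inner U (V - W) = inner U V - inner U W.
Proof. by rewrite !(innerC U) innerBl. Qed.

Lemma inner0l (p r : nat) (V : 'M[R]_(p, r)) : inner 0 V = 0.
Proof. by rewrite -(scale0r 0) innerZl mul0r. Qed.

Lemma inner0r (p r : nat) (V : 'M[R]_(p, r)) : inner V 0 = 0.
Proof. by rewrite innerC inner0l. Qed.

Lemma inner_sumr (J : finType) (p r : nat) (U : 'M[R]_(p, r))
    (F : J -> 'M[R]_(p, r)) :
  inner U (\sum_i F i) = \sum_i inner U (F i).
Proof.
by apply: (big_morph (inner U)) => [V W|]; rewrite ?innerDr ?inner0r.
Qed.

Lemma inner_ge0 (p r : nat) (U : 'M[R]_(p, r)) : 0 <= inner U U.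
Proof.
by rewrite innerE; apply: sumr_ge0 => i _; apply: sumr_ge0 => j _;
  rewrite -expr2 sqr_ge0.
Qed.

Lemma inner_eq0 (p r : nat) (U : 'M[R]_(p, r)) : inner U U = 0 -> U = 0.
Proof.
move=> U0; apply/matrixP => i j; rewrite mxE; apply/eqP.
rewrite -sqrf_eq0 eq_le sqr_ge0 andbT -U0 innerE.
rewrite (bigD1 i) //= (bigD1 j) //= -expr2 -addrA lerDl.
by apply: addr_ge0; do ?apply: sumr_ge0 => *; rewrite -?expr2 ?sqr_ge0 //;
  apply: sumr_ge0 => *; rewrite -expr2 sqr_ge0.
Qed.

Lemma enorm_sqr (p : nat) (u : 'cV[R]_p) : enorm u ^+ 2 = inner u u.
Proof. by rewrite sqr_sqrtr // inner_ge0. Qed.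

End Inner.

(** * Geometry of a simplex in the plane and in space *)

Section SimplexGeometry.
Context {R : realType}.
Variable d : nat.
Implicit Types (q : 'I_d -> 'cV[R]_d) (g : 'cV[R]_d).

Lemma nondegenerate_enorm q : nondegenerate_simplex q ->
  enorm (orientation q) != 0.
Proof.
by rewrite /nondegenerate_simplex /area; case: eqP => // ->; rewrite mul0r ltxx.
Qed.

Lemma unit_normal_sphere q : nondegenerate_simplex q -> sphere (unit_normal q).
Proof.
move=> /nondegenerate_enorm q0; rewrite /sphere /= /enorm.
rewrite innerZl innerZr -enorm_sqr expr2 mulKf // mulVf // sqrtr1 //.
Qed.

(** Turns area-weighted normals, which involve a square root, into polynomials
    in the vertices. *)
Lemma area_unit_normal q : nondegenerate_simplex q ->
  area q *: unit_normal q = d.-1%:R^-1 *: orientation q.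
Proof.
move=> /nondegenerate_enorm q0.
by rewrite /area /unit_normal scalerA mulrAC divff // mul1r.
Qed.

End SimplexGeometry.

Lemma orientation2E {R : realType} (q : 'I_2 -> 'cV[R]_2) :
  orientation q = perp (q 1 - q 0).
Proof. by []. Qed.

Lemma orientation3E {R : realType} (q : 'I_3 -> 'cV[R]_3) :
  orientation q = cross (q 1 - q 0) (q 2 - q 0).
Proof. by []. Qed.

Lemma ord2P (l : 'I_2) : l = 0 \/ l = 1.
Proof. by case: l => -[|[|//]] h; [left|right]; apply: val_inj. Qed.

Lemma ord3P (l : 'I_3) : [\/ l = 0, l = 1 | l = 2].
Proof.
by case: l => -[|[|[|//]]] h; [constructor 1|constructor 2|constructor 3];
  apply: val_inj.
Qed.

Section LowDimension.
Context {R : realType}.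

Lemma orientation_constant (d : nat) (q : 'I_d -> 'cV[R]_d) (l m : 'I_d) :
  d = 2%N \/ d = 3%N ->
  inner (orientation q) (q l) = inner (orientation q) (q m).
Proof.
case=> ?; subst d; rewrite ?orientation2E ?orientation3E !inner_colE ?sum_ord2 ?sum_ord3.
  by case: (ord2P l) (ord2P m) => -> [] ->; rewrite !mxE /=; ring.
by case: (ord3P l) (ord3P m) => -> [] ->; rewrite !mxE /=; ring.
Qed.

(** The orientation vector and the edges span the space.  The proof is Lagrange's
    identity: |g|^2 |J|^2 is (g . J)^2 plus the square of g . e (d = 2), or of
    g x (e1 x e2) expanded as a combination of g . e1 and g . e2 (d = 3). *)
Lemma orthogonal_eq0 (d : nat) (q : 'I_d -> 'cV[R]_d) (g : 'cV[R]_d) :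
  d = 2%N \/ d = 3%N -> orientation q != 0 ->
  inner g (orientation q) = 0 ->
  (forall l m, inner g (q l - q m) = 0) -> g = 0.
Proof.
move=> hd q0 gn gq; apply/inner_eq0/eqP.
have : inner (orientation q) (orientation q) != 0.
  by apply: contraNneq q0 => /inner_eq0 ->.
apply: contraNT => g0; apply/eqP/(mulfI g0); rewrite mulr0.
case: hd => ?; subst d.
  have -> : inner g g * inner (orientation q) (orientation q) =
     inner g (orientation q) ^+ 2 + inner g (q 1 - q 0) ^+ 2.
    by rewrite orientation2E !inner_colE !sum_ord2 !mxE /=; ring.
  by rewrite gn gq expr0n addr0.
have -> : inner g g * inner (orientation q) (orientation q) =
     inner g (orientation q) ^+ 2 +
     inner (inner g (q 2 - q 0) *: (q 1 - q 0) - inner g (q 1 - q 0) *: (q 2 - q 0))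
       (inner g (q 2 - q 0) *: (q 1 - q 0) - inner g (q 1 - q 0) *: (q 2 - q 0)).
  by rewrite orientation3E !inner_colE !sum_ord3 !mxE /=; ring.
by rewrite gn !gq !scale0r subrr inner0l expr0n addr0.
Qed.

End LowDimension.

(** * Tangential gradients *)

Section Gradient.
Context {R : realType}.
Variable d : nat.
Hypothesis hd : d = 2%N \/ d = 3%N.
Implicit Types (q : 'I_d -> 'cV[R]_d) (g : 'cV[R]_d) (u v : 'cV[R]_d -> R).

Lemma simplex_vertex q l : simplex q (q l).
Proof.
exists (fun i => (i == l)%:R); split.
- by move=> i; rewrite ler0n.
- by move=> i; rewrite inE.
- by rewrite (eq_bigr _ (fun i _ => mulrb _ _)) -big_mkcond big_pred1_eq.
- by under eq_bigr do rewrite scaler_nat mulrb; rewrite -big_mkcond big_pred1_eq.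
Qed.

Lemma orientation_simplex q (x : 'cV[R]_d) (m : 'I_d) : simplex q x ->
  inner (orientation q) x = inner (orientation q) (q m).
Proof.
case=> l [_ _ l1 ->]; rewrite inner_sumr.
under eq_bigr do rewrite innerZr (orientation_constant q _ m hd).
by rewrite -mulr_suml l1 mul1r.
Qed.

(** The property by which [grad] is chosen; it is named so that existence and
    uniqueness can be stated. *)
Definition is_grad q u g : Prop :=
  inner g (unit_normal q) = 0 /\
  forall x y, simplex q x -> simplex q y -> u y - u x = inner g (y - x).

Lemma is_grad_unique q u g g' : nondegenerate_simplex q ->
  is_grad q u g -> is_grad q u g' -> g = g'.
Proof.
move=> q0 [gn gu] [gn' gu'].
have e0 := nondegenerate_enorm q0.
apply/eqP; rewrite -subr_eq0; apply/eqP.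
apply: (orthogonal_eq0 hd (q := q)).
- by apply: contraNneq e0 => ->; rewrite /enorm inner0l sqrtr0.
- apply: (mulfI (invr_neq0 e0)).
  by rewrite -innerZr innerBl gn gn' subrr mulr0.
- move=> l m; rewrite innerBl -gu ?gu' ?subrr //; exact: simplex_vertex.
Qed.

(** The gradient is the slope of the affine function with its normal component
    removed, which does not affect increments along the simplex. *)
Lemma gradP q u : nondegenerate_simplex q -> affine_on (simplex q) u ->
  is_grad q u (grad q u).
Proof.
move=> q0 [a [c ua]]; apply: (@getPex _ (is_grad q u)).
have n1 : inner (unit_normal q) (unit_normal q) = 1.
  by rewrite -enorm_sqr unit_normal_sphere ?expr1n.
exists (a - inner a (unit_normal q) *: unit_normal q); split.
  by rewrite innerBl innerZl n1 mulr1 subrr.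
move=> x y xq yq; rewrite innerBl innerZl [inner (unit_normal q) _]innerZl.
have m : 'I_d by apply: (@Ordinal _ 0); case: hd => ->.
rewrite !innerBr (orientation_simplex m xq) (orientation_simplex m yq).
by rewrite subrr !mulr0 subr0 !ua // opprD addrACA subrr addr0.
Qed.

Lemma grad_eq q u g : nondegenerate_simplex q -> is_grad q u g -> grad q u = g.
Proof.
move=> q0 ug; apply: (is_grad_unique q0 _ ug).
by apply: (@getPex _ (is_grad q u)); exists g.
Qed.

Lemma gradB q u v : nondegenerate_simplex q ->
  affine_on (simplex q) u -> affine_on (simplex q) v ->
  grad q (fun x => u x - v x) = grad q u - grad q v.
Proof.
move=> q0 /(gradP q0) [un ud] /(gradP q0) [vn vd]; apply: grad_eq => //.
split; first by rewrite innerBl un vn subrr.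
by move=> x y xq yq; rewrite innerBl -ud // -vd // opprD addrACA -opprD.
Qed.

Lemma grad_cst q (c : R) : nondegenerate_simplex q -> grad q (fun=> c) = 0.
Proof.
move=> q0; apply: grad_eq => //; split=> [|x y _ _]; rewrite inner0l //.
by rewrite subrr.
Qed.

Lemma affine_on_coord (S : set 'cV[R]_d) i : affine_on S (fun x => x i 0).
Proof.
exists (delta_mx i 0), 0 => x _; rewrite addr0 inner_colE (bigD1 i) //= mxE !eqxx.
rewrite mul1r big1 ?addr0 // => j ji.
by rewrite mxE (negbTE ji) mul0r.
Qed.

Lemma jacB_id q (X : 'cV[R]_d -> 'cV[R]_d) : nondegenerate_simplex q ->
  (forall i, affine_on (simplex q) (fun x => X x i 0)) ->
  jac q (fun x => X x - x) = jac q X - jac q id.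
Proof.
move=> q0 Xa; apply/matrixP => i j; rewrite !mxE.
have -> : (fun x => (X x - x) i 0) = (fun x => X x i 0 - x i 0).
  by apply/funext => x; rewrite !mxE.
by rewrite gradB ?mxE //; exact: affine_on_coord.
Qed.

End Gradient.

(** * Test functions *)

Section FiniteElementSpace.
Context {R : realType} {d : nat} (T : connectivity d).
Implicit Types (q : 'I_(nvert T) -> 'cV[R]_d) (u v : 'cV[R]_d -> R).

Lemma affine_onB (S : set 'cV[R]_d) u v :
  affine_on S u -> affine_on S v -> affine_on S (fun x => u x - v x).
Proof.
move=> [a [c ua]] [b [e vb]]; exists (a - b), (c - e) => x xS.
by rewrite ua // vb // innerBl; ring.
Qed.

Lemma fespaceB q u v :
  fespace q u -> fespace q v -> fespace q (fun x => u x - v x).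
Proof.
move=> [uc ua] [vc va]; split=> [x|j]; last exact: affine_onB.
by apply: cvgB; [exact: uc|exact: vc].
Qed.

Lemma fespace_cst q (c : R) : fespace q (fun=> c).
Proof.
split=> [x|j]; first exact: cvg_cst.
by exists 0, c => x _; rewrite inner0l add0r.
Qed.

Lemma fevspaceB_id q (X : 'cV[R]_d -> 'cV[R]_d) :
  fevspace q X -> fevspace q (fun x => X x - x).
Proof.
move=> Xq i.
have -> : (fun x => (X x - x) i 0) = (fun x => X x i 0 - x i 0).
  by apply/funext => x; rewrite !mxE.
apply: fespaceB; [exact: Xq|split=> [|j]; last exact: affine_on_coord].
by apply: continuous_subspaceT; exact: coord_continuous.
Qed.

End FiniteElementSpace.

(** * Volume swept by a moving simplex *)

Section SweptVolume.
Context {R : realType}.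

(** The time average of the orientation vector while the vertices move linearly
    from q to q'. *)
Definition simpson (d : nat) (q q' : 'I_d -> 'cV[R]_d) : 'cV[R]_d :=
  6^-1 *: (orientation q + 4 *: orientation (fun l => 2^-1 *: (q l + q' l))
           + orientation q').

(** d (d - 1) times the signed volume of the cone with apex 0 over the
    simplex. *)
Definition cone (d : nat) (q : 'I_d -> 'cV[R]_d) : R :=
  d%:R^-1 * \sum_l inner (q l) (orientation q).

(** d (d - 1) times the signed volume swept by the simplex, as the time integral
    of its flux; the vertex displacements do not depend on time. *)
Definition swept (d : nat) (q q' : 'I_d -> 'cV[R]_d) : R :=
  \sum_l inner (q' l - q l) (simpson q q').

(** The cone over a segment is bounded by the segment and by two rays from 0,
    each attached to an end point; the correction is the area swept by them. *)
Lemma cone_diff2 (q q' : 'I_2 -> 'cV[R]_2) :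
  cone q' - cone q = swept q q'
    + (inner (q 1) (perp (q' 1)) - inner (q 0) (perp (q' 0))).
Proof.
rewrite /cone /swept /simpson !orientation2E !sum_ord2 !inner_colE !sum_ord2 !mxE /=.
by field.
Qed.

(** Six times the volume swept by the triangle (0, a, b).  In Simpson's rule for
    the product of a and b the weight 4 of the midpoint cancels against the two
    factors 1/2. *)
Definition edge_flux (a b a' b' : 'cV[R]_3) : R :=
  inner ((a' - a) + (b' - b)) (6^-1 *:
    (cross a b + cross (a + a') (b + b') + cross a' b')).

Lemma triple_productE (u v w : 'cV[R]_3) : inner u (cross v w) =
  u 0 0 * (v 1 0 * w 2 0 - v 2 0 * w 1 0) +
  u 1 0 * (v 2 0 * w 0 0 - v 0 0 * w 2 0) +
  u 2 0 * (v 0 0 * w 1 0 - v 1 0 * w 0 0).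
Proof. by rewrite inner_colE sum_ord3 !mxE. Qed.

Lemma edge_fluxC a b a' b' : edge_flux b a b' a' = - edge_flux a b a' b'.
Proof. rewrite /edge_flux !(innerZr, innerDr) !triple_productE !mxE; ring. Qed.

(** The cone over a triangle is a tetrahedron whose three other faces are the
    triangles (0, a, b) over the edges; the correction is the volume swept by
    these. *)
Lemma cone_diff3 (q q' : 'I_3 -> 'cV[R]_3) :
  cone q' - cone q = swept q q' -
    \sum_l edge_flux (q l) (q (ordS l)) (q' l) (q' (ordS l)).
Proof.
rewrite /cone /swept /simpson !orientation3E !sum_ord3.
have -> : ordS (0 : 'I_3) = 1 by apply: val_inj.
have -> : ordS (1 : 'I_3) = 2 by apply: val_inj.
have -> : ordS (2 : 'I_3) = 0 by apply: val_inj.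
rewrite /edge_flux !(innerZr, innerDr) !triple_productE.
rewrite !mxE.
by field.
Qed.

End SweptVolume.

(** * Cancellation on closed surfaces *)

Section ClosedSums.
Context {R : realType}.

Lemma closed_curve_sum (T : connectivity 2) (g : 'I_(nvert T) -> R) :
  closed_curve T -> \sum_j g (elt j 1) = \sum_j g (elt j 0).
Proof.
move=> hT.
have H (l : 'I_2) : (forall i, #|[set j : 'I_(nelt T) | elt j l == i]| = 1%N) ->
    \sum_j g (elt j l) = \sum_i g i.
  move=> h; rewrite (partition_big (fun j => elt j l) xpredT) //=.
  apply: eq_bigr => i _; rewrite (eq_bigr (fun=> g i)); last by move=> j /eqP ->.
  rewrite sumr_const (_ : #|_| = 1%N) //; apply: etrans (h i).
  (* the cardinal in h is that of a classical set *)
  by apply: eq_card => j; exact/esym/asboolb.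
by rewrite !H // => i; have [] := hT i.
Qed.

(** Summing an antisymmetric function over directed edges: each edge is counted
    as often as its reverse, so the sum equals its own opposite. *)
Lemma closed_triangulation_sum (T : connectivity 3)
    (h : 'I_(nvert T) -> 'I_(nvert T) -> R) :
  closed_triangulation T -> (forall a b, h b a = - h a b) ->
  \sum_(j < nelt T) \sum_l h (elt j l) (elt j (ordS l)) = 0.
Proof.
move=> [hT _] hN; rewrite pair_bigA /=.
set S := LHS.
have -> : S = \sum_a \sum_b h a b *+ #|dir_edges a b|.
  rewrite pair_bigA /= /S (partition_big
    (fun p : 'I_(nelt T) * 'I_3 => (elt p.1 p.2, elt p.1 (ordS p.2))) xpredT) //=.
  apply: eq_bigr => -[a b] _ /=.
  rewrite (eq_bigr (fun=> h a b)); last by move=> p /eqP [-> ->].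
  by rewrite sumr_const; congr (_ *+ _); rewrite cardsE; apply: eq_card.
set S' := LHS.
suff : S' = - S' by move=> e; lra.
rewrite {1}/S' exchange_big /= -sumrN; apply: eq_bigr => a _.
rewrite -sumrN; apply: eq_bigr => b _.
by rewrite hN mulNrn; have [_ ->] := hT a b.
Qed.

End ClosedSums.

Section Volume.
Context {R : realType}.
Variables (d : nat) (T : connectivity d).
Hypothesis hd : d = 2%N \/ d = 3%N.
Implicit Types q : 'I_(nvert T) -> 'cV[R]_d.

Lemma volumeE q : (forall j, nondegenerate_simplex (elem q j)) ->
  volume q = d%:R^-1 * d.-1%:R^-1 * \sum_j cone (elem q j).
Proof.
move=> q0; rewrite /volume -mulrA !big_distrr /=; apply: eq_bigr => j _.
have -> : area (elem q j) * (\sum_l inner (elem q j l) (nu q j)) =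
    d.-1%:R^-1 * \sum_l inner (elem q j l) (orientation (elem q j)).
  rewrite !big_distrr /=; apply: eq_bigr => l _.
  by rewrite -innerZr area_unit_normal // innerZr.
rewrite /cone expr2 invfM; ring.
Qed.

(** The enclosed volume changes exactly by the swept volume: the contributions of
    the lateral faces of the cones cancel in pairs. *)
Lemma cone_sum_swept q q' : closed_oriented T ->
  \sum_j cone (elem q' j) - \sum_j cone (elem q j) =
  \sum_j swept (elem q j) (elem q' j).
Proof.
move=> hT; rewrite -sumrB.
case: hd => ?; subst d.
  rewrite (eq_bigr _ (fun j _ => cone_diff2 (elem q j) (elem q' j))) big_split /=.
  rewrite sumrB (closed_curve_sum (fun i => inner (q i) (perp (q' i))) hT).
  by rewrite subrr addr0.
rewrite (eq_bigr _ (fun j _ => cone_diff3 (elem q j) (elem q' j))) sumrB.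
rewrite [X in _ - X](closed_triangulation_sum
  (h := fun a b => edge_flux (q a) (q b) (q' a) (q' b)) hT) ?subr0 // => a b.
exact: edge_fluxC.
Qed.

Lemma quad_normal_half q q' (c : R) :
  (forall j, nondegenerate_simplex (elem q j)) ->
  quad q (fun j l => inner (c *: (elem q' j l - elem q j l)) (normal_half q q' j))
    (traces q (fun=> 1)) =
  c * (d%:R^-1 * d.-1%:R^-1 * \sum_j swept (elem q j) (elem q' j)).
Proof.
move=> q0; rewrite /quad [RHS]mulrCA -!mulrA; congr (_ * _).
rewrite !big_distrr /=; apply: eq_bigr => j _.
rewrite /swept !big_distrr /=; apply: eq_bigr => l _.
have e0 := nondegenerate_enorm (q0 j).
have d1 : d.-1%:R != 0 :> R by rewrite pnatr_eq0; case: hd => ->.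
rewrite /traces mulr1 /normal_half /simpson /area !innerZr innerZl.
by field; rewrite e0 d1.
Qed.

End Volume.

(** * Convexity *)

Section Convex.
Context {R : realType}.

(** The derivative is taken relative to the interval, hence may be one-sided at
    s.  Approaching s along the segment towards t stays inside the interval,
    and there convexity bounds the difference quotient by the chord slope. *)
Lemma convex_above_tangent (I : set R) (g : R -> R) (s t : R) :
  is_interval I -> @convex_function R R^o I g -> derivable_in I g s ->
  I s -> I t ->
  deriv_in I g s * (t - s) <= g t - g s.
Proof.
move=> hI gI dg Is It.
have [->|ts] := eqVneq t s; first by rewrite !subrr mulr0.
pose p (e : R) := s + e * (t - s).
have p_cvg : p e @[e --> 0^'+] --> within I s^'.
  have p0 : p e @[e --> 0^'+] --> s.
    suff : p e @[e --> 0^'+] --> s + 0 * (t - s) by rewrite mul0r addr0.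
    apply: cvgD; first exact: cvg_cst.
    by apply: cvgM; [exact: cvg_within|exact: cvg_cst].
  move=> A /p0 pA.
  suff : \forall e \near 0^'+, A (p e) by [].
  near=> e.
  have e0 : 0 < e by near: e; exact: nbhs_right_gt.
  have e1 : e < 1 by near: e; exact: nbhs_right_lt.
  have : p e != s -> I (p e) -> A (p e) by near: e; exact: pA.
  apply.
    by rewrite /p -subr_eq0 addrC addKr mulf_neq0 ?subr_eq0 // gt_eqF.
  rewrite /p; case: (ltgtP s t) ts => // st _; [apply: (hI s t)|apply: (hI t s)] => //;
    apply/andP; split; nra.
have slope : diff_quot g s (p e) @[e --> 0^'+] --> deriv_in I g s.
  exact: (cvg_comp _ _ p_cvg dg).
have slope' : diff_quot g s (p e) * (t - s) @[e --> 0^'+] -->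
    deriv_in I g s * (t - s) by apply: cvgM slope _; exact: cvg_cst.
rewrite -(cvg_lim (@Rhausdorff R) slope'); apply: limr_le.
  by apply/cvg_ex; eexists; exact: slope'.
near=> e.
have e0 : 0 < e by near: e; exact: nbhs_right_gt.
have e1 : e <= 1 by near: e; exact: nbhs_right_le.
rewrite /diff_quot /p addrC addKr.
have := gI (Itv01 (ltW e0) e1) t s.
rewrite !inE => /(_ It Is); rewrite !convRE /= /unstable.onem => ge.
have -> : (e * (t - s))^-1 * (g (s + e * (t - s)) - g s) * (t - s) =
   (g (s + e * (t - s)) - g s) / e by field; rewrite subr_eq0 ts gt_eqF.
rewrite ler_pdivrMr //.
have <- : e * t + (1 - e) * s = s + e * (t - s) by ring.
nra.
Unshelve. all: by end_near.
Qed.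

End Convex.

(** * Dissipation *)

Lemma simplex_integral_cst {R : realType} (d : nat) (q : 'I_d -> 'cV[R]_d) (c : R) :
  d = 2%N \/ d = 3%N -> simplex_integral q (fun=> c) = area q * c.
Proof.
case=> ?; subst d; rewrite /simplex_integral /area -mulrA; congr (_ * _).
  rewrite Rintegral_cst //= lebesgue_measure_itv /= lte_fin ltr01 oppr0 adde0.
  by rewrite invr1 mul1r mulr1.
under eq_Rintegral => s.
  rewrite inE /= in_itv /= => /andP[s0 s1].
  rewrite Rintegral_cst //= lebesgue_measure_itv /= lte_fin.
  have -> : fine (if (0 < 1 - s)%R then (1 - s)%R%:E - 0%:E else 0)%E =
      unstable.onem (s : R) ^+ 1.
    rewrite expr1; case: ltP => [_|]; first by rewrite sube0.
    by rewrite /unstable.onem => ? /=; lra.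
  over.
rewrite RintegralZl //=.
  by rewrite Rintegral_onemXn mulrC.
apply: continuous_compact_integrable; first exact: segment_compact.
by apply: continuous_subspaceT => x; exact: continuous_onemXn.
Qed.

(** The vertex quadrature has weights of sum |sigma|, hence is exact on
    piecewise constant fields. *)
Lemma L2norm_cst_sqr {R : realType} (d : nat) (T : connectivity d)
    (q : 'I_(nvert T) -> 'cV[R]_d) (g : 'I_(nelt T) -> 'cV[R]_d) :
  d = 2%N \/ d = 3%N ->
  L2norm q (fun j _ => g j) ^+ 2 = quadv q (fun j _ => g j) (fun j _ => g j).
Proof.
move=> hd; have d0 : d%:R != 0 :> R by rewrite pnatr_eq0; case: hd => ->.
rewrite /L2norm /quadv; under eq_bigr do rewrite simplex_integral_cst //.
rewrite sqr_sqrtr; last first.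
  apply: sumr_ge0 => j _; rewrite mulr_ge0 ?sqr_ge0 // /area.
  by rewrite divr_ge0 ?sqrtr_ge0 ?ler0n.
rewrite big_distrr /=; apply: eq_bigr => j _.
by rewrite enorm_sqr sumr_const card_ord -[X in _ = _ * X]mulr_natr; field.
Qed.

(** * Energy of one element and the theorem *)

(** The old curvature value t enters only through the convexity inequality on the
    old element, the new value s through the threshold inequality, where it is
    held fixed while the element moves. *)
Lemma element_energy {R : realType} (d : nat) (I : set R)
    (f k0 : 'cV[R]_d -> R -> R) (q : 'I_d -> 'cV[R]_d)
    (X : 'cV[R]_d -> 'cV[R]_d) (c s t : R) :
  d = 2%N \/ d = 3%N -> is_interval I ->
  energy_density_assumption I f -> threshold I f k0 ->
  (forall i, affine_on (simplex q) (fun x => X x i 0)) ->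
  nondegenerate_simplex q -> nondegenerate_simplex (X \o q) ->
  I s -> I t -> k0 (unit_normal q) s <= c ->
  area (X \o q) * f (unit_normal (X \o q)) s - area q * f (unit_normal q) t <=
  area q * inner (Zmx f c (unit_normal q) s *m jac q X)
                 (jac q (fun x => X x - x)) +
  area q * (fH I f (unit_normal q) s * (s - t)).
Proof.
move=> hd hI hf hk0 Xa q0 q0' Is It kc.
have n1 := unit_normal_sphere q0.
have := thr_ineq hk0 Is q0 Xa q0' kc.
have := convex_above_tangent hI (eda_convex hf n1) (eda_derivable hf n1 Is) Is It.
move=> /(ler_wpM2l (ltW q0)); rewrite jacB_id // /fH; lra.
Qed.

Theorem theorem6p2 (R : realType) (d : nat) (hd : d = 2%N \/ d = 3%N)
  (I : set R) (hI : is_interval I)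
  (f : 'cV[R]_d -> R -> R)
  (hf : forall n s, sphere n -> 0 < f n s)
  (hfI : energy_density_assumption I f)
  (k0 : 'cV[R]_d -> R -> R) (hk0 : threshold I f k0)
  (k : 'cV[R]_d -> R -> R)
  (hk : forall n s, sphere n -> I s -> 0 <= k n s)
  (T : connectivity d) (q : 'I_(nvert T) -> 'cV[R]_d)
  (hGamma : closed_surface q)
  (hN : forall i, vsum q i != 0)
  (tau : R) (htau : 0 < tau)
  (X : 'cV[R]_d -> 'cV[R]_d) (H H' mu r : 'cV[R]_d -> R)
  (hX : fevspace q X) (hH : fespace q H) (hH' : fespace q H')
  (hmu : fespace q mu) (hr : fespace q r)
  (hnd : forall j, nondegenerate_simplex (elem q j))
  (hnd' : forall j, nondegenerate_simplex (elem (X \o q) j))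
  (hHI : forall i, I (H (q i))) (hH'I : forall i, I (H' (q i)))
  (hkk0 : forall j l,
     k0 (nu q j) (H' (elem q j l)) <= k (nu q j) (H' (elem q j l)))
  (eqX : forall phi, fespace q phi ->
     quad q
       (fun j l => inner (tau^-1 *: (X (elem q j l) - elem q j l))
                         (normal_half q (X \o q) j))
       (traces q phi)
     = - quadv q (fun j _ => gradT q mu j) (fun j _ => gradT q phi j))
  (eqmu : forall omega, fevspace q omega ->
     quadv q (fun j l => traces q mu j l *: normal_half q (X \o q) j)
             (traces q omega)
     = Dform f k q X omega H' + Bform q omega r)
  (eqH : forall psi, fespace q psi ->
     quad q (traces q (fun x => H' x - H x)) (traces q psi)
     = Bform q (fun x => X x - x) psi)
  (eqr : forall zeta, fespace q zeta ->
     quad q (traces q r) (traces q zeta)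
     = quad q (fun j l => fH I f (nu q j) (H' (elem q j l))) (traces q zeta)) :
  volume (X \o q) = volume q /\
  energy f (X \o q) (fun i => H' (q i))
    + tau * L2norm q (fun j _ => gradT q mu j) ^+ 2
  <= energy f q (fun i => H (q i)).
Proof.
have d0 : 0 < d%:R^-1 :> R by rewrite invr_gt0 ltr0n; case: hd => ->.
have hdX := fevspaceB_id hX.
split.
  apply/eqP; rewrite -subr_eq0; apply/eqP.
  rewrite !volumeE // -mulrBr (cone_sum_swept hd q (X \o q) (cs_closed hGamma)).
  (* 1/tau is the factor with which the displacement enters the first equation *)
  apply: (mulfI (invr_neq0 (lt0r_neq0 htau))); rewrite mulr0.
  rewrite -quad_normal_half //.
  rewrite [LHS](eqX _ (fespace_cst q 1)) /quadv.
  rewrite big1 ?mulr0 ?oppr0 // => j _; rewrite big1 // => l _.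
  by rewrite /gradT grad_cst // inner0r mulr0.
have dissip : tau * L2norm q (fun j => fun=> gradT q mu j) ^+ 2 =
    - (Dform f k q X (fun x => X x - x) H' +
       quad q (fun j l => fH I f (nu q j) (H' (elem q j l)))
         (traces q (fun x => H' x - H x))).
  rewrite -(eqr _ (fespaceB hH' hH)).
  have -> : quad q (traces q r) (traces q (fun x => H' x - H x)) =
      Bform q (fun x => X x - x) r.
    rewrite -(eqH _ hr); congr (_ * _).
    by apply: eq_bigr => j _; apply: eq_bigr => l _; rewrite [X in _ * X]mulrC.
  rewrite -(eqmu _ hdX) L2norm_cst_sqr //.
  have := eqX _ hmu => /(congr1 (fun x => - (tau * x))); rewrite mulrN opprK => <-.
  congr (- _); rewrite /quad /quadv mulrCA; congr (_ * _).
  rewrite big_distrr /=; apply: eq_bigr => j _.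
  rewrite big_distrr /=; apply: eq_bigr => l _.
  rewrite innerC innerZr /traces (innerZl (mu _)).
  by field; rewrite lt0r_neq0.
rewrite dissip lerBlDr -lerBlDl /energy /Dform /quad /quadv -mulrBr -mulrDr.
rewrite ler_pM2l // -sumrB -big_split; apply: ler_sum => j _.
rewrite !big_distrr -sumrB -big_split; apply: ler_sum => l _.
exact: (element_energy hd hI hfI hk0 (fun i => (hX i).2 j) (hnd j) (hnd' j)
  (hH'I _) (hHI _) (hkk0 j l)).
Qed.
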